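(* Let $d\ge 3$ be an integer. For every $\alpha\in(0,1)\cup(1,\infty)$, \[ \min_{x} H_{\alpha}(P_x)=\min \left\{ \log 2,\ \frac{1}{1-\alpha}\log \left( \frac{(d-1)^{\alpha}+(d-1)^{1-\alpha}}{d^{\alpha}}\right)\right\}, \] where $x$ runs over all vectors in $\mathbb R^d$ with $\|x\|_2=1$ and $\sum_{i=1}^d x_i=0$. Moreover (the case $\alpha\to1$), \[ \min_{x} H(P_x)=\begin{cases}\log 2,& d\le 6;\\[1mm] \log d-\dfrac{d-2}{d}\log (d-1),& d\ge 7,\end{cases} \] where $x$ runs over the same set of vectors.
   Context: For a probability vector $p=(p_i)_{i=1}^d$ and $\alpha\in(0,1)\cup(1,\infty)$, the $\alpha$-Rényi entropy is $H_\alpha(p)=\frac{1}{1-\alpha}\log\sum_i p_i^\alpha$, and the Shannon entropy is $H(p)=-\sum_i p_i\log p_i$ (with $0\log 0=0$). Here $\log$ is the natural logarithm. For $x\in\mathbb R^d$ with $\|x\|_2=\left(\sum_i x_i^2\right)^{1/2}=1$, $P_x:=(|x_i|^2)_{i=1}^d$ is the associated probability vector. *)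

(* Defs.v *)
From mathcomp Require Import all_boot all_order all_algebra.
From mathcomp Require Import all_classical all_reals all_analysis.

Set Implicit Arguments.
Unset Strict Implicit.
Unset Printing Implicit Defensive.

Import Order.TTheory GRing.Theory Num.Theory.

Local Open Scope classical_set_scope.
Local Open Scope ring_scope.

(* For a != 0, 0 `^ a = 0, so zero entries of p
   contribute nothing to the sum. *)
Definition renyi_entropy (R : realType) (d : nat) (alpha : R)
    (p : 'rV[R]_d) : R :=
  (1 - alpha)^-1 * ln (\sum_(i < d) p 0 i `^ alpha).

(* The convention 0 log 0 = 0 holds because of the factor p 0 i. *)
Definition shannon_entropy (R : realType) (d : nat) (p : 'rV[R]_d) : R :=
  - \sum_(i < d) p 0 i * ln (p 0 i).

(* The library norm on 'rV[R]_d is the sup norm. *)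
Definition norm2 (R : realType) (d : nat) (x : 'rV[R]_d) : R :=
  Num.sqrt (\sum_(i < d) x 0 i ^+ 2).

Definition prob_of (R : realType) (d : nat) (x : 'rV[R]_d) : 'rV[R]_d :=
  \row_(i < d) `|x 0 i| ^+ 2.

Definition unit_sum0 (R : realType) (d : nat) : set 'rV[R]_d :=
  [set x | norm2 x = 1 /\ \sum_(i < d) x 0 i = 0].

Definition is_min_on (R : realType) (T : Type) (D : set T) (f : T -> R)
    (m : R) : Prop :=
  (f @` D) m /\ lbound (f @` D) m.

(* Main.v *)
Require Import Defs.
From mathcomp Require Import all_boot all_order all_algebra.
From mathcomp Require Import all_classical all_reals all_analysis.
From mathcomp Require Import ring lra.

Set Implicit Arguments.
Unset Strict Implicit.
Unset Printing Implicit Defensive.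

Import Order.TTheory GRing.Theory Num.Theory.
Import numFieldNormedType.Exports.

Local Open Scope classical_set_scope.
Local Open Scope ring_scope.

(** Put q = 2 alpha, p = q - 1 and d = n + 2.  Minimizing the entropy means
    maximizing the sum of the |x_i|^q when alpha > 1 and minimizing it when
    alpha < 1; multiplying every comparison by alpha - 1, or by
    p - 1 = 2 (alpha - 1), treats the two cases together.  The two candidate
    values come from (1, -1, 0, ..., 0) and (d - 1, -1, ..., -1), normalized.

    Let M be the largest |x_i|.  If M^2 <= 1/2, comparing each (x_i^2)^alpha
    with a multiple of x_i^2 already gives the value log 2.  If M^2 > 1/2, the
    other |x_i| have sum at least M, because the coordinates cancel, and sum of
    squares 1 - M^2.  When alpha <= 1/2 the function u^q is so concave that the
    bound on their sum suffices.  When alpha > 1/2, the extremal configuration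
    of nonnegative numbers under these two constraints is (B, t, ..., t) with
    t <= B (lemma [sum_powR_equal_variables]): the quadratic polynomial that is
    tangent to z^q at t and meets it again at B lies on the right side of z^q
    on [0, B].

    Scaling by B leaves the curve of vectors (1 + n s, -1, -s, ..., -s) with
    s = t / B in [0, 1], which joins the two candidates.  Along it the
    q-norm relative to the Euclidean norm is extremal at an end
    ([norm_ratio_extremal]), because its derivative has the sign of a function
    [critical] that vanishes at both ends and changes sign at most once
    ([critical_sign]).  For p >= 2 this is Bernoulli's inequality; for p < 2
    the second derivative of [critical] is, up to a positive factor, a monotone
    function of s / (1 + n s), and Rolle-type counting of zeros
    ([vanishing_ends_sign]) concludes.

    The Shannon entropy is the limit of the Renyi entropies at order 1, so its
    lower bound follows by passage to the limit; which of the two candidates is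
    smaller then amounts to comparing d^d with 2^d (d - 1)^(d - 2). *)

(** * Derivatives and the mean value theorem on the half-line *)

(** Not being a type class, this form of the derivative is computed by the
    tactic below without any instance search. *)
Definition has_derivative (R : realType) (f : R -> R) (x df : R) : Prop :=
  is_derive x 1 f df.

Section has_derivative_rules.
Context {R : realType}.
Implicit Types (f g : R -> R) (x a b df dg : R).

Lemma has_derivative_eq f x df dg :
  has_derivative f x df -> df = dg -> has_derivative f x dg.
Proof. by move=> + <-. Qed.

Lemma has_derivativeD f g x df dg : has_derivative f x df ->
  has_derivative g x dg -> has_derivative (fun y => f y + g y) x (df + dg).
Proof. by move=> ? ?; exact: is_deriveD. Qed.

Lemma has_derivativeN f x df :
  has_derivative f x df -> has_derivative (fun y => - f y) x (- df).
Proof. by move=> ?; exact: is_deriveN. Qed.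

Lemma has_derivativeM f g x df dg :
  has_derivative f x df -> has_derivative g x dg ->
  has_derivative (fun y => f y * g y) x (f x * dg + g x * df).
Proof. by move=> ? ?; exact: is_deriveM. Qed.

Lemma has_derivativeX f x df n : has_derivative f x df ->
  has_derivative (fun y => f y ^+ n) x (n%:R * f x ^+ n.-1 * df).
Proof.
rewrite /has_derivative => fdf; have -> : (fun y => f y ^+ n) = f ^+ n.
  by apply/funext => y; elim: n => [|n IHn]; rewrite ?expr0// !exprS IHn.
exact: is_deriveX.
Qed.

Lemma has_derivative_powR f x df a : 0 < f x -> has_derivative f x df ->
  has_derivative (fun y => f y `^ a) x (a * f x `^ (a - 1) * df).
Proof.
by move=> fx0 fdf; have /is_derive1_comp/(_ fdf) := is_derive1_powR a fx0.
Qed.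

Lemma has_derivative_expR f x df : has_derivative f x df ->
  has_derivative (fun y => expR (f y)) x (expR (f x) * df).
Proof.
by move=> fdf; have /is_derive1_comp/(_ fdf) := is_derive_expR (f x).
Qed.

Lemma has_derivative_ln f x df : 0 < f x -> has_derivative f x df ->
  has_derivative (fun y => ln (f y)) x ((f x)^-1 * df).
Proof.
by move=> fx0 fdf; have /is_derive1_comp/(_ fdf) := is_derive1_ln fx0.
Qed.

Lemma has_derivative_cst a x : has_derivative (fun=> a) x 0.
Proof. exact: is_derive_cst. Qed.

Lemma has_derivative_id x : has_derivative (fun y : R => y) x 1.
Proof. exact: is_derive_id. Qed.

Lemma has_derivative_cvg f x df :
  has_derivative f x df -> f y @[y --> x] --> f x.
Proof.
by move=> [fdf _]; apply: differentiable_continuous; exact/derivable1_diffP.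
Qed.

End has_derivative_rules.

Ltac derivative_step := lazymatch goal with
  | |- has_derivative (fun y => y) _ _ => eapply has_derivative_id
  | |- has_derivative (fun _ => ?a) _ _ => eapply has_derivative_cst
  (* unification leaves linear and affine factors in this eta-reduced form *)
  | |- has_derivative ( *%R ?a) _ _ =>
      apply: (@has_derivativeM _ (fun=> a) (fun y => y))
  | |- has_derivative ( +%R ?a) _ _ =>
      apply: (@has_derivativeD _ (fun=> a) (fun y => y))
  | |- has_derivative -%R _ _ => apply: (@has_derivativeN _ (fun y => y))
  | |- has_derivative (fun y => (@?f y) + (@?g y)) _ _ => eapply has_derivativeD
  | |- has_derivative (fun y => - (@?f y)) _ _ => eapply has_derivativeN
  | |- has_derivative (fun y => (@?f y) * (@?g y)) _ _ => eapply has_derivativeM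
  | |- has_derivative (fun y => (@?f y) ^+ _) _ _ => eapply has_derivativeX
  | |- has_derivative (fun y => (@?f y) `^ _) _ _ => eapply has_derivative_powR
  end.

(** Leaves the positivity of the bases of the real powers as side conditions. *)
Ltac derivative := repeat derivative_step.

Section mean_value.
Context {R : realType}.
Variables (f df : R -> R).
Hypothesis fdf : forall x : R, 0 < x -> has_derivative f x (df x).

Lemma MVT_gt0 (a b : R) : 0 < a -> a < b ->
  exists2 c, a < c < b & f b - f a = df c * (b - a).
Proof.
move=> a0 ab; have [||c cab E] := @MVT R f df a b ab.
- by move=> x; rewrite in_itv /= => /andP[ax _]; exact/fdf/(lt_trans a0 ax).
- apply: derivable_within_continuous => x; rewrite in_itv /= => /andP[ax _].
  by have [] := fdf (lt_le_trans a0 ax).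
- by exists c.
Qed.

Hypothesis f0 : f x @[x --> 0^'+] --> f 0.

(** Real powers are not differentiable at 0, so that the only endpoint where
    continuity has to be assumed is 0. *)
Lemma MVT_ge0 (a b : R) : 0 <= a -> a < b ->
  exists2 c, a < c < b & f b - f a = df c * (b - a).
Proof.
rewrite le_eqVlt => /predU1P[<- b0|]; last exact: MVT_gt0.
have cf (x : R) : 0 < x -> f y @[y --> x] --> f x.
  by move=> /fdf; exact: has_derivative_cvg.
have [||c cab E] := @MVT R f df 0 b b0.
- by move=> x; rewrite in_itv /= => /andP[x0 _]; exact/fdf.
- apply/continuous_within_itvP => //; split => //.
  + by move=> x; rewrite in_itv /= => /andP[x0 _]; exact/cf.
  + exact/cvg_at_left_filter/cf.
by exists c => //; move: cab; rewrite in_itv.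
Qed.

Lemma derive_ge0_le (a b : R) : 0 <= a -> a <= b ->
  (forall x, a < x < b -> 0 <= df x) -> f a <= f b.
Proof.
move=> a0; rewrite le_eqVlt => /predU1P[-> //|ab] df0.
have [c cab E] := MVT_ge0 a0 ab.
by rewrite -subr_ge0 E mulr_ge0 ?df0// subr_ge0 ltW.
Qed.

Lemma derive_le0_ge (a b : R) : 0 <= a -> a <= b ->
  (forall x, a < x < b -> df x <= 0) -> f b <= f a.
Proof.
move=> a0; rewrite le_eqVlt => /predU1P[-> //|ab] df0.
have [c cab E] := MVT_ge0 a0 ab.
by rewrite -subr_le0 E mulr_le0_ge0 ?df0// subr_ge0 ltW.
Qed.

End mean_value.

(** If [f] were positive somewhere before [s] and negative somewhere after, the
    two zeros at the ends would make [df] take a positive, a negative and again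
    a positive value, hence [ddf] a negative value before a positive one. *)
Lemma vanishing_ends_sign (R : realType) (f df ddf : R -> R) (s : R) :
  (forall x : R, 0 < x -> has_derivative f x (df x)) ->
  (forall x : R, 0 < x -> has_derivative df x (ddf x)) ->
  f x @[x --> 0^'+] --> f 0 -> f 0 = 0 -> f 1 = 0 ->
  (forall x y : R, 0 < x -> x < y -> y < 1 -> ddf x <= 0 -> ddf y <= 0) ->
  0 < s < 1 ->
  (forall x : R, 0 < x < s -> f x <= 0) \/ (forall x, s < x < 1 -> 0 <= f x).
Proof.
move=> fdf fddf cf f00 f10 dd /andP[s0 s1].
have [|] := pselect (forall x : R, 0 < x < s -> f x <= 0); first by left.
move=> /existsNP[x1 /not_implyP[/andP[x10 x1s] /negP]].
rewrite -ltNge => fx1; right=> x2 /andP[sx2 x21].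
rewrite leNgt; apply/negP => fx2.
have x12 := lt_trans x1s sx2.
have x20 := lt_trans x10 x12.
have [u /andP[u0 ux] Eu] := MVT_ge0 fdf cf (lexx 0) x10.
have [v /andP[v0 vx] Ev] := MVT_ge0 fdf cf (ltW x10) x12.
have [w /andP[w0 wx] Ew] := MVT_ge0 fdf cf (ltW x20) x21.
have dfu : 0 < df u.
  by move: Eu; rewrite f00 !subr0 => E; rewrite -(pmulr_lgt0 _ x10) -E.
have dfv : df v < 0.
  by rewrite -(pmulr_llt0 _ (_ : 0 < x2 - x1)) ?subr_gt0// -Ev; lra.
have dfw : 0 < df w.
  by rewrite -(pmulr_lgt0 _ (_ : 0 < 1 - x2)) ?subr_gt0// -Ew; lra.
have uv := lt_trans ux v0; have vw := lt_trans vx w0.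
have v00 := lt_trans u0 uv.
have [y1 /andP[uy1 y1v] E1] := MVT_gt0 fddf u0 uv.
have [y2 /andP[vy2 y2w] E2] := MVT_gt0 fddf v00 vw.
have d1 : ddf y1 <= 0.
  by apply: ltW; rewrite -(pmulr_llt0 _ (_ : 0 < v - u)) ?subr_gt0// -E1; lra.
have d2 : 0 < ddf y2.
  by rewrite -(pmulr_lgt0 _ (_ : 0 < w - v)) ?subr_gt0// -E2; lra.
have := dd y1 y2 (lt_trans u0 uy1) (lt_trans y1v vy2) (lt_trans y2w wx) d1.
by rewrite leNgt d2.
Qed.

(** * Bernoulli's inequality and convexity of powers *)

Section powers.
Context {R : realType}.
Implicit Types (w v r p a b c : R).

(** The factor [r - 1] merges the convex case [r > 1] and the concave case
    [r < 1]; the first is Young's inequality with one factor equal to 1, the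
    second follows by applying the first to [w `^ r] and [r^-1]. *)
Lemma Bernoulli_powR w r : 0 <= w -> 0 < r ->
  0 <= (r - 1) * (w `^ r - (1 + r * (w - 1))).
Proof.
have H w' r' : 0 <= w' -> 1 < r' -> 1 + r' * (w' - 1) <= w' `^ r'.
  move=> w0 r1.
  have r0 : 0 < r' by lra.
  have rn0 : r' != 0 by rewrite gt_eqF.
  have q0 : 0 < r' / (r' - 1) by apply: divr_gt0; lra.
  have rn1 : r' - 1 != 0 by rewrite gt_eqF//; lra.
  have pq1 : r'^-1 + (r' / (r' - 1))^-1 = 1 by field; rewrite rn0 rn1.
  have := @conjugate_powR R w' 1 r' (r' / (r' - 1)) w0 ler01 r0 q0 pq1.
  rewrite powR1 mulr1 -subr_ge0 => H; rewrite -subr_ge0.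
  rewrite (_ : _ - _ = r' * (w' `^ r' / r' + 1 / (r' / (r' - 1)) - w')).
    by rewrite mulr_ge0// ltW.
  by field; rewrite rn0 rn1.
move=> w0 r0; have [r1|r1|->] := ltrgtP r 1.
- rewrite -mulrNN mulr_ge0 ?oppr_ge0; [lra|lra|idtac].
  have := H (w `^ r) r^-1 (powR_ge0 _ _).
  rewrite -powRrM mulfV ?gt_eqF// powRr1// invf_gt1// => /(_ r1) H1.
  have : r * (1 + r^-1 * (w `^ r - 1)) <= r * w by rewrite ler_pM2l.
  rewrite (_ : r * (1 + _) = r + w `^ r - 1); first lra.
  by field; rewrite gt_eqF.
- by rewrite mulr_ge0 ?subr_ge0 ?(ltW r1)// H.
- by rewrite subrr mul0r.
Qed.

Lemma powR_tangent v w r : 0 < v -> 0 <= w -> 0 < r ->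
  0 <= (r - 1) * (w `^ r - (v `^ r + r * v `^ (r - 1) * (w - v))).
Proof.
move=> v0 w0 r0; have vn0 : v != 0 by rewrite gt_eqF.
have := Bernoulli_powR (divr_ge0 w0 (ltW v0)) r0.
rewrite -(pmulr_rge0 _ (powR_gt0 r v0)).
rewrite -[X in (X / v) `^ r]mulr1 mulrAC powRM ?divr_ge0 ?(ltW v0)// powR1
  mulr1.
have -> : w `^ r = v `^ r * (w / v) `^ r.
  by rewrite -powRM ?divr_ge0 ?(ltW v0)// mulrC divfK.
rewrite powRB ?vn0 ?implybT// powRr1 ?(ltW v0)//.
rewrite [X in _ -> 0 <= X](_ : _ = v `^ r *
  ((r - 1) * ((w / v) `^ r - (1 + r * (w / v - 1))))) //.
by field.
Qed.

(** The comparison of a power with its chords: the tangent inequality at [b],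
    averaged over [a] and [c]. *)
Lemma powR_chord a b c p : 0 <= a -> a < b -> b < c -> 0 < p ->
  0 <= (p - 1) * ((c - b) * a `^ p + (b - a) * c `^ p - (c - a) * b `^ p).
Proof.
move=> a0 ab bc p0.
have b0 : 0 < b by lra.
have Ha := powR_tangent b0 a0 p0.
have Hc := powR_tangent b0 (_ : 0 <= c) p0; have {}Hc := Hc ltac:(lra).
have {Ha}Ha := mulr_ge0 (_ : 0 <= c - b) Ha; have {}Ha := Ha ltac:(lra).
have {Hc}Hc := mulr_ge0 (_ : 0 <= b - a) Hc; have {}Hc := Hc ltac:(lra).
have := addr_ge0 Ha Hc; congr (0 <= _); ring.
Qed.

End powers.

(** * The equal variables principle *)

Section certificate.
Context {R : realType}.
Implicit Types (p t B z : R).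

(** The divided difference of [z `^ (p + 1)] at [t, t, B]. *)
Definition divided_difference p t B : R :=
  (B `^ (p + 1) - t `^ (p + 1) - (p + 1) * t `^ p * (B - t)) / (B - t) ^+ 2.

(** The quadratic polynomial tangent to [z `^ (p + 1)] at [t] and meeting it
    at [B]. *)
Definition tangent_secant p t B z : R :=
  t `^ (p + 1) + (p + 1) * t `^ p * (z - t)
  + divided_difference p t B * (z - t) ^+ 2.

(** The difference [f] of the two functions vanishes at [t] and [B], so its
    derivative vanishes at [t] and at some [r] between them; up to a factor
    this derivative compares [z `^ p] with its chord over [t, r], which gives
    its sign on each side of [t] and [r].  The first conclusion, the sign of
    the linear coefficient of the quadratic polynomial, is the derivative at 0;
    it lets a mere lower bound on a sum of arguments be used. *)
Lemma tangent_secantP p t B : 0 < p -> 0 < t < B ->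
  (p - 1) * ((p + 1) * t `^ p - 2 * divided_difference p t B * t) <= 0 /\
  forall z, 0 <= z <= B ->
    0 <= (p - 1) * (tangent_secant p t B z - z `^ (p + 1)).
Proof.
move=> p0 /andP[t0 tB].
pose Q := tangent_secant p t B; pose c := divided_difference p t B.
have [->|pn1] := eqVneq p 1; first by rewrite subrr; split=> [|z _];
  rewrite mul0r.
pose f z := (p - 1) * (Q z - z `^ (p + 1)).
pose df z := (p - 1) * ((p + 1) * t `^ p + 2 * c * (z - t) - (p + 1) * z `^ p).
have fdf (x : R) : 0 < x -> has_derivative f x (df x).
  move=> x0; apply: has_derivative_eq.
    rewrite /f /Q /tangent_secant -/c.
    by derivative.
  rewrite /df addrK /=; ring.
have f0 : f x @[x --> 0^'+] --> f 0.
  rewrite /f /Q /tangent_secant -/c.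
  have cX : (x : R) @[x --> 0^'+] --> (0 : R).
    exact/cvg_at_right_filter/cvg_id.
  apply: cvgM; first exact: cvg_cst.
  apply: cvgB; last first.
    by rewrite powR0 ?gt_eqF// ?addr_gt0//; apply: powR_cvg0; rewrite addr_gt0.
  apply: cvgD; last first.
    apply: cvgM; first exact: cvg_cst.
    by rewrite !expr2; apply: cvgM; apply: cvgB => //; exact: cvg_cst.
  apply: cvgD; first exact: cvg_cst.
  by apply: cvgM; [exact: cvg_cst|apply: cvgB => //; exact: cvg_cst].
have ft : f t = 0.
  by rewrite /f /Q /tangent_secant subrr expr0n !mulr0 !addr0 subrr mulr0.
have fB : f B = 0.
  rewrite /f /Q /tangent_secant /divided_difference divfK; first by ring.
  by rewrite expf_neq0// subr_eq0 gt_eqF.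
have [r /andP[tr rB]] := MVT_ge0 fdf f0 (ltW t0) tB.
rewrite ft fB subrr => /esym/eqP; rewrite mulf_eq0 subr_eq0 (gt_eqF tB) orbF.
rewrite mulf_eq0 subr_eq0 (negPf pn1) /= subr_eq0 => /eqP Er.
have dfE z : df z * (r - t) = (p + 1) * ((p - 1) *
    ((r - z) * t `^ p + (z - t) * r `^ p - (r - t) * z `^ p)).
  rewrite /df.
  have -> : (p + 1) *
      ((p - 1) * ((r - z) * t `^ p + (z - t) * r `^ p - (r - t) * z `^ p))
    = (p - 1) * ((p + 1) * (r - z) * t `^ p + (z - t) * ((p + 1) * r `^ p)
      - (p + 1) * (r - t) * z `^ p) by ring.
  rewrite -Er; ring.
have rt : 0 < r - t by rewrite subr_gt0.
have p1 : 0 < p + 1 by rewrite addr_gt0.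
have dfL z : 0 <= z -> z < t -> df z <= 0.
  move=> z0 zt; rewrite -(pmulr_lle0 _ rt) dfE (pmulr_rle0 _ p1).
  rewrite -oppr_ge0; have := powR_chord z0 zt tr p0.
  by congr (0 <= _); ring.
have dfM z : t < z -> z < r -> 0 <= df z.
  move=> tz zr; rewrite -(pmulr_lge0 _ rt) dfE (pmulr_rge0 _ p1).
  exact: powR_chord (ltW t0) tz zr p0.
have dfR z : r < z -> df z <= 0.
  move=> rz; rewrite -(pmulr_lle0 _ rt) dfE (pmulr_rle0 _ p1).
  rewrite -oppr_ge0; have := powR_chord (ltW t0) tr rz p0.
  by congr (0 <= _); ring.
split.
  rewrite -/c; have := dfL 0 (lexx 0) t0; rewrite /df powR0 ?gt_eqF//.
  by congr (_ <= 0); ring.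
move=> z /andP[z0 zB]; rewrite -/Q -/(f z).
have [zt|tz] := leP z t.
  rewrite -ft; apply: (derive_le0_ge fdf f0 z0 zt) => x /andP[zx xt].
  by rewrite dfL//; exact: le_trans (ltW zx).
have [zr|rz] := leP z r.
  rewrite -ft; apply: (derive_ge0_le fdf f0 (ltW t0) (ltW tz)) =>
    x /andP[tx xz].
  by rewrite dfM//; exact: lt_le_trans zr.
rewrite -fB; apply: (derive_le0_ge fdf f0 z0 zB) => x /andP[zx xB].
by rewrite dfR//; exact: lt_trans zx.
Qed.

(** Summing the comparison of [z `^ (p + 1)] with [tangent_secant] bounds the
    sum of powers by a combination of the sum and the sum of squares, with
    equality at [(B, t, ..., t)].  That all arguments lie in [0, B], as the
    comparison requires, holds because the constraints bound the sum of the
    [(y i - t) ^+ 2] by [(B - t) ^+ 2]. *)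
Lemma sum_powR_equal_variables (I : finType) (A : {pred I}) (y : I -> R)
    (n : nat) p t B : #|A| = n.+1 -> 0 < p -> 0 < t <= B ->
  (forall i, i \in A -> 0 <= y i) ->
  B + n%:R * t <= \sum_(i in A) y i ->
  \sum_(i in A) y i ^+ 2 = B ^+ 2 + n%:R * t ^+ 2 ->
  0 <= (p - 1) * (B `^ (p + 1) + n%:R * t `^ (p + 1)
                  - \sum_(i in A) y i `^ (p + 1)).
Proof.
move=> cA p0 /andP[t0 tB] y0 s1 s2.
have sq : \sum_(i in A) (y i - t) ^+ 2 <= (B - t) ^+ 2.
  under eq_bigr do rewrite sqrrB.
  rewrite big_split /= sumr_const cA -mulr_natl sumrB s2.
  rewrite sumrMnl -mulr_suml -[_ *+ 2]mulr_natl.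
  have := ler_wpM2r (ltW t0) s1.
  rewrite -natr1; lra.
have yB i : i \in A -> 0 <= y i <= B.
  move=> iA; rewrite y0//=.
  have : (y i - t) ^+ 2 <= (B - t) ^+ 2.
    apply: le_trans sq; rewrite (bigD1 i)//= lerDl sumr_ge0// => j _.
    exact: sqr_ge0.
  rewrite leNgt => /negP H; rewrite leNgt; apply/negP => By; apply: H.
  by rewrite ltr_sqr ?nnegrE ?subr_ge0 ?ltrD2r// (le_trans tB)// ltW.
have [Bt|tneB] := eqVneq B t.
  have yE i : i \in A -> y i = B.
    move=> iA; have : (y i - t) ^+ 2 <= 0.
      have -> : 0 = (B - t) ^+ 2 by rewrite Bt subrr expr0n.
      apply: le_trans sq; rewrite (bigD1 i)//= lerDl sumr_ge0// => j _.
      exact: sqr_ge0.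
    by rewrite -[_ <= 0]orFb real_exprn_even_le0 //= ?num_real // subr_eq0 Bt
      => /eqP.
  rewrite (eq_bigr (fun=> B `^ (p + 1))); last by move=> i /yE ->.
  by rewrite sumr_const cA -Bt -(mulr_natl _ n.+1) -natr1 [leRHS](_ : _ = 0)//;
    ring.
have {tneB}tB' : t < B by rewrite lt_neqAle eq_sym tneB.
have [] := tangent_secantP p0 (introT andP (conj t0 tB')).
set c := divided_difference p t B; set Q := tangent_secant p t B => c1 QP.
pose a := t `^ (p + 1) - (p + 1) * t `^ p * t + c * t ^+ 2.
pose b := (p + 1) * t `^ p - 2 * c * t.
have QE z : Q z = a + b * z + c * z ^+ 2.
  by rewrite /Q /tangent_secant -/c /a /b; ring.
have H : (p - 1) * (\sum_(i in A) y i `^ (p + 1))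
    <= (p - 1) * (\sum_(i in A) Q (y i)).
  rewrite !mulr_sumr; apply: ler_sum => i iA.
  by rewrite -subr_ge0 -mulrBr; apply: QP; exact: yB.
rewrite mulrBr subr_ge0; apply: le_trans H _.
have -> : \sum_(i in A) Q (y i) = n.+1%:R * a + b * (\sum_(i in A) y i)
    + c * (B ^+ 2 + n%:R * t ^+ 2).
  under eq_bigr do rewrite QE.
  by rewrite big_split big_split /= sumr_const cA -!mulr_sumr s2 (mulr_natl a).
have -> : B `^ (p + 1) + n%:R * t `^ (p + 1)
    = n.+1%:R * a + b * (B + n%:R * t) + c * (B ^+ 2 + n%:R * t ^+ 2).
  have -> : B `^ (p + 1) = Q B.
    rewrite /Q /tangent_secant /divided_difference divfK; first by ring.
    by rewrite expf_neq0// subr_eq0 gt_eqF.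
  have -> : t `^ (p + 1) = Q t.
    by rewrite /Q /tangent_secant; ring.
  by rewrite !QE -natr1; ring.
rewrite -subr_ge0.
have : 0 <= - ((p - 1) * b) * (\sum_(i in A) y i - (B + n%:R * t)).
  by rewrite mulr_ge0 ?oppr_ge0 ?subr_ge0.
by congr (0 <= _); ring.
Qed.

End certificate.

(** * Sign of the critical function along the one-parameter family *)

Section one_parameter.
Context {R : realType}.
Implicit Types (n p s : R).

(** Up to a positive factor, the derivative in [s] of the quotient [norm_ratio]
    below; also, up to sign, the determinant with rows [(1, u, |u|^p sgn u)]
    for the three values [u = 1 + n s, -1, -s], whose vanishing is the
    Lagrange condition. *)
Definition critical p n s : R :=
  (1 - s) * (1 + n * s) `^ p + (2 + n * s) * s `^ p - (1 + (n + 1) * s).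

Lemma powRS (w p : R) : 0 < w -> w `^ (p + 1) = w * w `^ p.
Proof.
by move=> w0; rewrite powRD ?(gt_eqF w0) ?implybT// powRr1 ?(ltW w0)// mulrC.
Qed.

(** Bernoulli's inequality bounds [critical p] below by the affine function of
    [p] that agrees with it at [p = 1], where it vanishes, and at [p = 2], where
    it is explicitly nonnegative. *)
Lemma critical_ge0 p n s : 2 <= n -> 2 <= p -> 0 < s < 1 -> 0 <= critical p n s.
Proof.
move=> n2 p2 /andP[s0 s1]; set M := 1 + n * s.
have M0 : 0 < M by rewrite addr_gt0// mulr_gt0//; lra.
have H w : 0 < w -> w + (p - 1) * (w ^+ 2 - w) <= w `^ p.
  move=> w0; have := Bernoulli_powR (ltW w0) (_ : 0 < p - 1) =>
    /(_ ltac:(lra)) H.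
  rewrite -{2}(subrK 1 p) powRS// -subr_ge0.
  have -> : w * w `^ (p - 1) - (w + (p - 1) * (w ^+ 2 - w))
    = w * (w `^ (p - 1) - (1 + (p - 1) * (w - 1))) by ring.
  rewrite (pmulr_rge0 _ w0).
  have [p2'|p2'] := eqVneq p 2.
    by rewrite p2' (_ : 2 - 1 = 1) ?powRr1 ?(ltW w0)//; lra.
  by move: H; rewrite pmulr_rge0//; lra.
have HM : 0 <= (1 - s) * (M `^ p - (M + (p - 1) * (M ^+ 2 - M))).
  by rewrite mulr_ge0 ?subr_ge0 ?(ltW s1)// H.
have Hs : 0 <= (M + 1) * (s `^ p - (s + (p - 1) * (s ^+ 2 - s))).
  by rewrite mulr_ge0 ?subr_ge0 ?H//; lra.
have H0 : 0 <= (p - 1) * (1 - s) * s * (n * M - M - 1).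
  rewrite !mulr_ge0//; [lra|lra|lra|].
  rewrite (_ : _ - _ - 1 = (n - 2) * M + n * s); last by rewrite /M; ring.
  by rewrite addr_ge0// mulr_ge0//; lra.
have := addr_ge0 (addr_ge0 HM Hs) H0; congr (0 <= _).
by rewrite /critical -/M /M; ring.
Qed.

(** For [n = 1] the function [critical p] vanishes identically in [s] both at
    [p = 1] and at [p = 3], and it is convex in [p]. *)
Lemma critical1_sign p s : 1 < p -> 0 < s < 1 -> 0 <= (p - 3) * critical p 1 s.
Proof.
move=> p1 /andP[s0 s1]; set M := 1 + 1 * s.
have M0 : 0 < M by rewrite /M; lra.
pose r := (p - 1) / 2.
have r0 : 0 < r by rewrite divr_gt0//; lra.
have H w : 0 < w -> 0 <= (r - 1) * (w `^ p - (w + r * (w ^+ 3 - w))).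
  move=> w0; have := Bernoulli_powR (sqr_ge0 w) r0.
  have -> : (w ^+ 2) `^ r = w `^ (p - 1).
    rewrite -powR_mulrn ?(ltW w0)// -powRrM; congr (_ `^ _).
    by rewrite /r; field.
  rewrite -[in w `^ p](subrK 1 p) powRS// -(pmulr_rge0 _ w0).
  by congr (0 <= _); ring.
have HM := mulr_ge0 (_ : 0 <= 2 * (1 - s)) (H _ M0).
have {}HM := HM ltac:(lra).
have Hs := mulr_ge0 (_ : 0 <= 2 * (M + 1)) (H _ s0).
have {}Hs := Hs ltac:(lra).
have := addr_ge0 HM Hs; congr (0 <= _).
by rewrite /critical -/M /M /r; field.
Qed.

(** With [d = 2 - p] and [y = t^-1] this is the sign of the derivative of
    [curvature] below.  When the left-hand side is positive, [d < 1] and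
    [y `^ d] is at most [1 + d * (y - 1)]; the resulting product of two affine
    functions of [y] is bounded through the square of a weighted sum of them
    that does not involve [y]. *)
Lemma powR_slope_bound (n d y : R) : 1 <= n -> 0 < d -> n + 1 <= y ->
  y `^ d * (n * (1 + d) - 2 * d * y) <= n ^+ 2 * (n + 1).
Proof.
move=> n1 d0 ny.
have y0 : 0 < y by lra.
have n0 : 0 <= n ^+ 2 * (n + 1) by rewrite mulr_ge0 ?sqr_ge0//; lra.
have [b0|b0] := leP (n * (1 + d) - 2 * d * y) 0.
  by apply: le_trans n0; rewrite mulr_ge0_le0// powR_ge0.
have d1 : d < 1.
  rewrite ltNge; apply/negP => d1.
  have : 0 <= d * (y - (n + 1)) by rewrite mulr_ge0//; lra.
  have : 0 <= n * (d - 1) by rewrite mulr_ge0//; lra.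
  lra.
have B : y `^ d <= 1 + d * (y - 1).
  have := Bernoulli_powR (ltW y0) d0.
  by rewrite nmulr_rge0 ?subr_le0//; lra.
apply: le_trans (ler_wpM2r (ltW b0) B) _.
have : (1 + d * (y - 1)) * (n * (1 + d) - 2 * d * y)
   <= ((1 - d) * 2 + n * (1 + d)) ^+ 2 / 8.
  rewrite -subr_ge0.
  have := sqr_ge0 (2 * (1 + d * (y - 1)) - (n * (1 + d) - 2 * d * y)).
  move/(divr_ge0)/(_ (_ : 0 <= 8)) => /(_ ltac:(lra)).
  by congr (0 <= _); field.
move=> /le_trans; apply.
have e0 : 0 <= (1 - d) * 2 + n * (1 + d) by rewrite addr_ge0// mulr_ge0//; lra.
have e1 : (1 - d) * 2 + n * (1 + d) <= 2 * n + 2.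
  have : 0 <= (1 - d) * n by rewrite mulr_ge0//; lra.
  lra.
have e2 : ((1 - d) * 2 + n * (1 + d)) ^+ 2 <= (2 * n + 2) ^+ 2.
  by rewrite ler_sqr ?nnegrE//; lra.
rewrite ler_pdivrMr//; apply: le_trans e2 _.
rewrite -subr_ge0 (_ : _ - _ = 4 * (n + 1) * (2 * n ^+ 2 - n - 1)); last
  by ring.
rewrite mulr_ge0//; first lra.
rewrite (_ : _ - 1 = (2 * n + 1) * (n - 1)); last by ring.
by rewrite mulr_ge0//; lra.
Qed.

(** [p - 1] times the second derivative of [critical p n] at [s], divided by
    the positive number [p * (1 + n * s) `^ (p - 1)] and written in terms of
    [t = s / (1 + n * s)], where only one transcendental quantity remains. *)
Definition curvature p n t : R :=
  2 * (p - 1) ^+ 2 * t `^ (p - 2) + (p - 1) * n * (3 - p) * t `^ (p - 1)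
  + (p - 1) * (n ^+ 2 * (p - 1) - 2 * n)
  - n ^+ 2 * (n + 1) * (p - 1) ^+ 2 * t.

Lemma curvature_nincr p n t u : 1 <= n -> p < 2 ->
  0 < t -> t < u -> u < (n + 1)^-1 -> curvature p n u <= curvature p n t.
Proof.
move=> n1 p2 t0 tu un.
pose df t := (p - 1) ^+ 2 * (2 * (p - 2) * t `^ (p - 3)
   + n * (3 - p) * t `^ (p - 2) - n ^+ 2 * (n + 1)).
have fdf (x : R) : 0 < x -> has_derivative (curvature p n) x (df x).
  move=> x0; apply: has_derivative_eq; first by rewrite /curvature; derivative.
  have e3 : p - 2 - 1 = p - 3 by ring.
  have e2 : p - 1 - 1 = p - 2 by ring.
  rewrite /df e3 e2; move: (x `^ _) (x `^ _) => a b.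
  ring.
have [c /andP[tc cu] E] := MVT_gt0 fdf t0 tu.
rewrite -subr_le0 E mulr_le0_ge0 ?subr_ge0 ?(ltW tu)//.
have c0 := lt_trans t0 tc.
have cy : n + 1 <= c^-1.
  by rewrite -[n + 1]invrK lef_pV2 ?posrE ?invr_gt0//;
    [exact/ltW/(lt_trans cu)|lra].
have := powR_slope_bound n1 (_ : 0 < 2 - p) cy => /(_ ltac:(lra)).
have -> : c^-1 `^ (2 - p) = c `^ (p - 2).
  by rewrite -powR_inv1 ?(ltW c0)// -powRrM; congr (_ `^ _); ring.
have E2 : c `^ (p - 3) = c^-1 * c `^ (p - 2).
  rewrite (_ : p - 2 = (p - 3) + 1); last by ring.
  by rewrite powRS// mulKf ?gt_eqF.
move=> H; rewrite /df mulr_ge0_le0 ?sqr_ge0// E2 subr_le0.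
by apply: le_trans H; rewrite le_eqVlt; apply/orP; left; apply/eqP; ring.
Qed.

(** The sign pattern, negative then positive after multiplication by [p - 1],
    is the one for which the ends of the family are extremal. *)
Lemma critical_sign p n s : 0 < p -> n = 1 \/ 2 <= n -> 0 < s < 1 ->
  (forall x, 0 < x < s -> (p - 1) * critical p n x <= 0) \/
  (forall x, s < x < 1 -> 0 <= (p - 1) * critical p n x).
Proof.
move=> p0 n12 s01.
have n1 : 1 <= n by case: n12 => ?; lra.
have /andP[s0 s1] := s01.
have [p2|p2] := leP 2 p.
  have p1 : 0 < p - 1 by lra.
  have [n1'|n2] := n12; last first.
    right=> x /andP[sx x1]; rewrite pmulr_rge0//; apply: critical_ge0 => //.
    by rewrite x1 (lt_trans s0).
  rewrite n1'; have [p3|p3] := leP 3 p; last first.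
    left=> x /andP[x0 xs]; rewrite pmulr_rle0//.
    have := @critical1_sign p x (_ : 1 < p) (_ : 0 < x < 1).
    rewrite x0 (lt_trans xs)// => /(_ ltac:(lra) isT).
    by rewrite nmulr_rge0 //; lra.
  right=> x /andP[sx x1]; rewrite pmulr_rge0//.
  have [->|p3'] := eqVneq p 3.
    rewrite /critical !powR_mulrn; [|lra|lra].
    rewrite [leRHS](_ : _ = 0)//; ring.
  have := @critical1_sign p x (_ : 1 < p) (_ : 0 < x < 1).
  rewrite (lt_trans s0 sx) x1 => /(_ ltac:(lra) isT).
  by rewrite pmulr_rge0// subr_gt0 lt_neqAle eq_sym p3'.
pose f x := (p - 1) * critical p n x.
pose df x := (p - 1) * (- (1 + n * x) `^ p
  + n * p * (1 - x) * (1 + n * x) `^ (p - 1)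
  + n * x `^ p + p * (2 + n * x) * x `^ (p - 1) - (n + 1)).
pose ddf x := p * (1 + n * x) `^ (p - 1) * curvature p n (x / (1 + n * x)).
have M0 (x : R) : 0 <= x -> 0 < 1 + n * x.
  by move=> x0; rewrite ltr_wpDr// mulr_ge0//; lra.
have Mn0 (x : R) : 0 < x -> 1 + n * x != 0.
  by move=> /ltW/M0; rewrite lt0r => /andP[].
apply: (@vanishing_ends_sign R f df ddf s _ _ _ _ _ _ s01).
- move=> x x0; apply: has_derivative_eq.
    rewrite /f /critical; derivative => //; exact/M0/ltW.
  by rewrite /df; ring.
- move=> x x0; apply: has_derivative_eq.
    rewrite /df; derivative => //; exact/M0/ltW.
  rewrite /ddf /curvature /=.
  have MM0 := M0 _ (ltW x0).
  have Mx0 := Mn0 _ x0.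
  have e2 : p - 1 - 1 = p - 2 by ring.
  have e1 w : 0 < w -> w `^ (p - 1) = w * w `^ (p - 2).
    by move=> w0; rewrite -powRS//; congr (_ `^ _); ring.
  have e3 : (x / (1 + n * x)) `^ (p - 2)
      = x `^ (p - 2) / (1 + n * x) `^ (p - 2).
    by rewrite powRM ?invr_ge0 ?(ltW x0) ?(ltW MM0)// -powR_inv1 ?(ltW MM0)//
      powRAC powR_inv1 ?powR_ge0.
  have k0 : (1 + n * x) `^ (p - 2) != 0 by rewrite gt_eqF ?powR_gt0.
  rewrite e2 !e1 ?divr_gt0// e3.
  move: (x `^ _) ((1 + n * x) `^ (p - 2)) k0 => a b b0.
  by field; rewrite Mx0.
- rewrite /f /critical.
  have cX : (x : R) @[x --> 0^'+] --> (0 : R).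
    exact/cvg_at_right_filter/cvg_id.
  have cM : (1 + n * x) `^ p @[x --> 0^'+] --> (1 + n * 0) `^ p.
    apply: cvg_at_right_filter.
    apply: (@has_derivative_cvg _ (fun x => (1 + n * x) `^ p)).
    by derivative; rewrite mulr0 addr0.
  have cn (a b : R) : a + b * x @[x --> 0^'+] --> a + b * 0.
    by apply: cvgD; [exact: cvg_cst|apply: cvgM => //; exact: cvg_cst].
  apply: cvgM; first exact: cvg_cst.
  apply: cvgB; last exact: cn.
  apply: cvgD; first by apply: cvgM => //; apply: cvgB => //; exact: cvg_cst.
  by apply: cvgM => //; rewrite powR0 ?gt_eqF//; exact: powR_cvg0.
- by rewrite /f /critical mulr0 powR0 ?gt_eqF// addr0 powR1; ring.
- rewrite /f /critical powR1; ring.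
move=> x y x0 xy y1; rewrite /ddf.
have y0 := lt_trans x0 xy.
rewrite !pmulr_rle0 ?mulr_gt0 ?powR_gt0 ?M0 ?(ltW x0) ?(ltW y0)//.
apply: le_trans; apply: curvature_nincr => //.
- by rewrite divr_gt0// M0// ltW.
- rewrite ltr_pdivrMr ?M0 ?(ltW x0)// mulrAC ltr_pdivlMr ?M0 ?(ltW y0)//.
  by rewrite -subr_gt0 (_ : _ - _ = y - x) ?subr_gt0//; ring.
- rewrite ltr_pdivrMr ?M0 ?(ltW y0)// mulrC ltr_pdivlMr; last by lra.
  lra.
Qed.

End one_parameter.

(** * The one-parameter family is extremal at its ends *)

Section norm_ratio.
Context {R : realType}.
Implicit Types (n p s : R).

(** The sum of the [p + 1]-st powers of the absolute values of the coordinates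
    of [(1 + n s, -1, -s, ..., -s)] after normalization to Euclidean norm 1. *)
Definition norm_ratio p n s : R :=
  ((1 + n * s) `^ (p + 1) + 1 + n * s `^ (p + 1))
  * ((1 + n * s) ^+ 2 + 1 + n * s ^+ 2) `^ (- ((p + 1) / 2)).

(** The derivative of [norm_ratio p n] is a positive multiple of
    [critical p n]. *)
Lemma norm_ratio_extremal p n s : 0 < p -> n = 1 \/ 2 <= n -> 0 <= s <= 1 ->
  0 <= (p - 1) * (norm_ratio p n 0 - norm_ratio p n s) \/
  0 <= (p - 1) * (norm_ratio p n 1 - norm_ratio p n s).
Proof.
move=> p0 n12 /andP[]; rewrite le_eqVlt => /predU1P[<- _|s0].
  by left; rewrite subrr mulr0.
rewrite le_eqVlt => /predU1P[->|s1]; first by right; rewrite subrr mulr0.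
have n0 : 0 < n by case: n12 => ?; lra.
pose f x := (p - 1) * norm_ratio p n x.
pose D x := (1 + n * x) ^+ 2 + 1 + n * x ^+ 2.
pose k x := (p + 1) * n * D x `^ (- ((p + 1) / 2) - 1).
pose df x := k x * ((p - 1) * critical p n x).
have M0 (x : R) : 0 <= x -> 0 < 1 + n * x.
  by move=> x0; rewrite ltr_wpDr// mulr_ge0// ltW.
have D0 (x : R) : 0 <= x -> 0 < D x.
  move=> x0; rewrite /D ltr_wpDr ?mulr_ge0 ?sqr_ge0 ?(ltW n0)//.
  by rewrite ltr_wpDl ?sqr_ge0.
have k0 (x : R) : 0 <= x -> 0 < k x.
  by move=> x0; rewrite /k !mulr_gt0 ?powR_gt0 ?D0//; lra.
have fdf (x : R) : 0 < x -> has_derivative f x (df x).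
  move=> x0; apply: has_derivative_eq.
    rewrite /f /norm_ratio; derivative => //; first exact/M0/ltW.
    exact/D0/ltW.
  have DE : D x `^ (- ((p + 1) / 2)) = D x * D x `^ (- ((p + 1) / 2) - 1).
    by rewrite -powRS ?D0 ?(ltW x0)// subrK.
  rewrite /df /k /critical -/(D x) DE !addrK !powRS ?M0 ?(ltW x0)//.
  rewrite /D; move: (_ `^ (_ - 1)) (x `^ p) ((1 + n * x) `^ p) => a b c.
  by field.
have f0 : f x @[x --> 0^'+] --> f 0.
  have cX : (x : R) @[x --> 0^'+] --> (0 : R).
    exact/cvg_at_right_filter/cvg_id.
  rewrite /f /norm_ratio; apply: cvgM; first exact: cvg_cst.
  apply: cvgM; last first.
    apply: cvg_at_right_filter; apply: (@has_derivative_cvg _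
      (fun x => ((1 + n * x) ^+ 2 + 1 + n * x ^+ 2) `^ (- ((p + 1) / 2)))).
    by derivative; exact: D0.
  apply: cvgD; last first.
    apply: cvgM; first exact: cvg_cst.
    by rewrite powR0 ?gt_eqF ?addr_gt0//; apply: powR_cvg0; rewrite addr_gt0.
  apply: cvgD; last exact: cvg_cst.
  apply: cvg_at_right_filter.
  apply: (@has_derivative_cvg _ (fun x => (1 + n * x) `^ (p + 1))).
  by derivative; exact: M0.
rewrite !mulrBr !subr_ge0 -!/(f _).
have [H|H] := critical_sign p0 n12 (introT andP (conj s0 s1)).
  left; apply: (derive_le0_ge fdf f0 (lexx 0) (ltW s0)) => x /andP[x0 xs].
  by rewrite /df pmulr_rle0 ?H ?x0// k0// ltW.
right; apply: (derive_ge0_le fdf f0 (ltW s0) (ltW s1)) => x /andP[sx x1].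
by rewrite /df pmulr_rge0 ?H ?sx// k0// ltW// (lt_trans s0).
Qed.

End norm_ratio.

(** * Sums of powers over vectors of sum 0 and Euclidean norm 1 *)

Section power_sums.
Context {R : realType}.
Implicit Types (a p r u v w : R).

Lemma powR_monotone_sign r v w : 0 < v -> v <= w -> 0 <= r * (w `^ r - v `^ r).
Proof.
move=> v0 vw; have w0 := lt_le_trans v0 vw.
have [r0|/ltW r0] := leP 0 r.
  by rewrite mulr_ge0// subr_ge0 ge0_ler_powR// nnegrE ltW.
rewrite -mulrNN mulr_ge0 ?oppr_ge0// subr_le0.
rewrite -[r]opprK (powRN w) (powRN v) lef_pV2 ?posrE ?powR_gt0//.
by rewrite ge0_ler_powR ?nnegrE ?oppr_ge0// ltW.
Qed.

Lemma two_point_term a u : 0 < a -> 0 <= u <= 2^-1 ->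
  0 <= (a - 1) * (2 `^ (1 - a) * u - u `^ a).
Proof.
move=> a0 /andP[]; rewrite le_eqVlt => /predU1P[<- _|u0 u2].
  by rewrite powR0 ?gt_eqF// mulr0 subrr mulr0.
have -> : u `^ a = u `^ (a - 1) * u.
  by rewrite -[in LHS](subrK 1 a) powRS// mulrC.
have -> : 2 `^ (1 - a) = 2^-1 `^ (a - 1).
  by rewrite -powR_inv1// -powRrM mulN1r opprB.
by rewrite -mulrBl mulrA mulr_ge0 ?(ltW u0)// powR_monotone_sign.
Qed.

(** The numbers [B] and [t] solve [B + n t = M] and [B^2 + n t^2 = 1 - M^2].
    This system is solvable by Cauchy-Schwarz, and [t > 0] because
    [M^2 > 1/2]. *)
Lemma sum_powR_gt_half (I : finType) (i0 : I) (y : I -> R) (n : nat) p :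
  #|I| = n.+2 -> (0 < n)%N -> 0 < p ->
  (forall i, 0 <= y i) -> \sum_i y i ^+ 2 = 1 ->
  y i0 <= \sum_(i | i != i0) y i -> 2^-1 < y i0 ^+ 2 ->
  0 <= (p - 1) * (norm_ratio p n%:R 0 - \sum_i y i `^ (p + 1)) \/
  0 <= (p - 1) * (norm_ratio p n%:R 1 - \sum_i y i `^ (p + 1)).
Proof.
move=> cI n0 p0 y0 y2 yi0 M2.
set M := y i0 in yi0 M2.
have M0 : 0 <= M by exact: y0.
have N1 : 1 <= n%:R :> R by rewrite ler1n.
have N12 : n%:R = 1 :> R \/ 2 <= n%:R :> R.
  by case: n n0 {cI N1} => [//|[|n]] _; [left|right; rewrite ler_nat].
move: N1 N12; set N : R := n%:R => N1 N12.
have cA : #|[pred i | i != i0]| = n.+1.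
  by have := cardC1 i0; rewrite cI.
have s2 : \sum_(i | i != i0) y i ^+ 2 = 1 - M ^+ 2.
  by move: y2; rewrite (bigD1 i0)//= -/M => <-; rewrite addrAC subrr add0r.
have MN : M ^+ 2 * (N + 2) <= N + 1.
  (* Cauchy-Schwarz, from the squared distances to the mean M / (N + 1) *)
  pose c := M / (N + 1).
  have : 0 <= \sum_(i | i != i0) (y i - c) ^+ 2.
    by apply: sumr_ge0 => i _; exact: sqr_ge0.
  under eq_bigr do rewrite sqrrB.
  rewrite big_split /= sumr_const cA -(mulr_natl _ n.+1) sumrB s2.
  rewrite sumrMnl -mulr_suml -(mulr_natl _ 2) -natr1 -/N => H.
  have c0 : 0 <= c by rewrite divr_ge0//; lra.
  have := ler_wpM2r c0 yi0.
  have Mc : M = c * (N + 1) by rewrite /c divfK// gt_eqF//; lra.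
  move=> Hc; have N10 : 0 <= N + 1 by lra.
  have : 0 <= 1 - M ^+ 2 - c ^+ 2 * (N + 1).
    have E : M * c = c ^+ 2 * (N + 1) by rewrite {1}Mc; ring.
    by rewrite E in Hc; lra.
  move=> /(mulr_ge0 N10) Hc2; rewrite -subr_ge0; move: Hc2; congr (0 <= _).
  by rewrite Mc; ring.
pose r := Num.sqrt (N * (N + 1 - (N + 2) * M ^+ 2)).
have r2 : r ^+ 2 = N * (N + 1 - (N + 2) * M ^+ 2).
  by rewrite sqr_sqrtr// mulr_ge0//; lra.
have r0 : 0 <= r by exact: sqrtr_ge0.
pose t := (N * M - r) / (N * (N + 1)).
pose B := M - N * t.
have NN0 : 0 < N * (N + 1) by rewrite mulr_gt0//; lra.
have Nn0 : N != 0 by rewrite gt_eqF//; lra.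
have N1n0 : N + 1 != 0 by rewrite gt_eqF//; lra.
have t0 : 0 < t.
  have N0 : 0 <= N by lra.
  rewrite divr_gt0// subr_gt0 -ltr_sqr ?nnegrE ?mulr_ge0//.
  rewrite r2 exprMn -subr_gt0 (_ : _ - _ = N * (N + 1) * (2 * M ^+ 2 - 1));
    last by ring.
  by rewrite mulr_gt0//; lra.
have BtE : B - t = r / N by rewrite /B /t; field; rewrite Nn0 N1n0.
have tB : t <= B by rewrite -subr_ge0 BtE divr_ge0//; lra.
have B0 : 0 < B by lra.
have B2 : B ^+ 2 + N * t ^+ 2 = 1 - M ^+ 2.
  have -> : B ^+ 2 + N * t ^+ 2
      = M ^+ 2 + (r ^+ 2 - N ^+ 2 * M ^+ 2) / (N * (N + 1)).
    by rewrite /B /t; field; rewrite Nn0 N1n0.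
  by rewrite r2; field; rewrite Nn0 N1n0.
have H1 : 0 <= (p - 1) * (B `^ (p + 1) + N * t `^ (p + 1)
                  - \sum_(i | i != i0) y i `^ (p + 1)).
  have := @sum_powR_equal_variables R I [pred i | i != i0] y n p t B cA p0.
  rewrite t0 tB => /(_ isT); apply => //.
  - by rewrite -/N /B subrK.
  - by rewrite s2 B2.
pose s := t / B.
have s01 : 0 <= s <= 1.
  by rewrite divr_ge0 ?(ltW t0) ?(ltW B0)//= ler_pdivrMr// mul1r.
have Bn0 : B != 0 by rewrite gt_eqF.
have valG : norm_ratio p N s = M `^ (p + 1) + (B `^ (p + 1) + N * t `^ (p + 1)).
  have Ms : 1 + N * s = M / B by rewrite /s /B; field.
  have D2 : (1 + N * s) ^+ 2 + 1 + N * s ^+ 2 = B ^- 2.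
    rewrite Ms /s; apply: (mulIf (expf_neq0 2 Bn0)); rewrite mulVf ?expf_neq0//.
    rewrite (_ : _ * B ^+ 2 = M ^+ 2 + (B ^+ 2 + N * t ^+ 2)); last by field.
    by rewrite B2; ring.
  rewrite /norm_ratio D2 Ms.
  have -> : (B ^- 2) `^ (- ((p + 1) / 2)) = B `^ (p + 1).
    by rewrite -powR_invn ?(ltW B0)// -powRrM (_ : - 2%:R * _ = p + 1)//; field.
  have /andP[s0 _] := s01.
  rewrite !mulrDl mul1r -mulrA -!powRM ?(ltW B0)//; last
    by rewrite divr_ge0 ?(ltW B0).
  by rewrite /s !divfK// addrA.
have HS : \sum_i y i `^ (p + 1)
    = M `^ (p + 1) + \sum_(i | i != i0) y i `^ (p + 1).
  by rewrite (bigD1 i0).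
have H2 : 0 <= (p - 1) * (norm_ratio p N s - \sum_i y i `^ (p + 1)).
  by rewrite HS valG; move: H1; congr (0 <= _); ring.
have [H|H] := norm_ratio_extremal p0 N12 s01; [left|right];
  by have := addr_ge0 H H2; congr (0 <= _); ring.
Qed.

End power_sums.

Section power_sum_bound.
Context {R : realType}.
Implicit Types (a : R).

Lemma norm_ratio0 a (n : R) : 0 < a ->
  norm_ratio (2 * a - 1) n 0 = 2 `^ (1 - a).
Proof.
move=> a0; rewrite /norm_ratio subrK mulr0 addr0 powR1 powR0; last
  by rewrite gt_eqF//; lra.
rewrite expr1n expr0n !mulr0 !addr0 powRB ?pnatr_eq0 ?implybT// powRr1// -powRN.
by congr (_ * _ `^ _); field.
Qed.

Lemma norm_ratio1 a (n : R) : 0 <= n -> norm_ratio (2 * a - 1) n 1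
  = ((n + 1) `^ a + (n + 1) `^ (1 - a)) / (n + 2) `^ a.
Proof.
move=> n0; have k0 : 0 < n + 1 by lra.
have d0 : 0 < n + 2 by lra.
rewrite /norm_ratio subrK mulr1 powR1 expr1n mulr1.
have -> : (1 + n) ^+ 2 + 1 + n = (n + 1) * (n + 2) by ring.
rewrite powRM ?(ltW k0) ?(ltW d0)// (_ : 2 * a / 2 = a); last by field.
rewrite -addrA (addrC 1) !powRN powRB ?(gt_eqF k0) ?implybT//.
rewrite powRr1 ?(ltW k0)//.
rewrite (_ : 2 * a = a + a); last by ring.
rewrite powRD ?(gt_eqF k0) ?implybT//.
have : (n + 1) `^ a != 0 by rewrite gt_eqF ?powR_gt0.
have : (n + 2) `^ a != 0 by rewrite gt_eqF ?powR_gt0.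
move: (_ `^ _) (_ `^ _) => b c b0 c0.
by field; rewrite b0 c0.
Qed.

(** If the largest [`|x i|] has square at most 1/2, the terms are compared one
    by one; otherwise [sum_powR_gt_half] applies when [a > 1/2], and for
    [a <= 1/2] the largest coordinate and all the others each contribute at
    least [`|x i0| `^ (2 * a)]. *)
Lemma power_sum_bound (I : finType) (x : I -> R) (n : nat) a :
  #|I| = n.+2 -> (0 < n)%N -> 0 < a ->
  \sum_i x i = 0 -> \sum_i x i ^+ 2 = 1 ->
  0 <= (a - 1) * (2 `^ (1 - a) - \sum_i (x i ^+ 2) `^ a) \/
  0 <= (a - 1) * (((n%:R + 1) `^ a + (n%:R + 1) `^ (1 - a)) / (n%:R + 2) `^ a
                  - \sum_i (x i ^+ 2) `^ a).
Proof.
move=> cI n0 a0 x1 x2.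
pose y i := `|x i|.
have y0 i : 0 <= y i by exact: normr_ge0.
have yx i : y i ^+ 2 = x i ^+ 2 by rewrite /y real_normK ?num_real.
have y2 : \sum_i y i ^+ 2 = 1 by rewrite -x2; apply: eq_bigr => i _.
have [j _] : {j : I | true}.
  by have : (0 < #|I|)%N by [rewrite cI]; case/card_gt0P/sigW => j _; exists j.
case: (@arg_maxP _ _ I j xpredT y isT) => i0 _ ymax.
have [M2|M2] := leP (y i0 ^+ 2) 2^-1.
  left; have -> : 2 `^ (1 - a) = \sum_i 2 `^ (1 - a) * y i ^+ 2.
    by rewrite -mulr_sumr y2 mulr1.
  rewrite -sumrB mulr_sumr.
  apply: sumr_ge0 => i _; rewrite -yx; apply: two_point_term => //.
  by rewrite sqr_ge0/= (le_trans _ M2)// ler_sqr ?nnegrE ?y0//; exact: ymax.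
have yi0 : y i0 <= \sum_(i | i != i0) y i.
  have -> : y i0 = `|\sum_(i | i != i0) x i|.
    move: x1; rewrite (bigD1 i0)//= => /eqP; rewrite addr_eq0 => /eqP E.
    by rewrite /y E normrN.
  exact: ler_norm_sum.
have M0 : 0 < y i0.
  rewrite lt_neqAle y0 andbT eq_sym; apply/eqP => E.
  by move: M2; rewrite E expr0n/=; lra.
have ya i : (x i ^+ 2) `^ a = y i `^ (2 * a).
  by rewrite -yx -powR_mulrn// -powRrM.
have [a2|a2] := leP a 2^-1; last first.
  have p0 : 0 < 2 * a - 1 by lra.
  have := sum_powR_gt_half cI n0 p0 y0 y2 yi0 M2.
  rewrite norm_ratio0// norm_ratio1 ?ler0n// subrK.
  under eq_bigr do rewrite -ya.
  by case=> H; [left|right]; rewrite -(pmulr_rge0 _ (_ : 0 < 2))//;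
    move: H; congr (0 <= _); ring.
(* a <= 1/2: each y i `^ (2 * a) is at least y i * y i0 `^ (2 * a - 1) *)
left; under eq_bigr do rewrite ya.
rewrite -mulrNN mulr_ge0 ?oppr_ge0 ?subr_le0//; first lra.
have H i : y i * y i0 `^ (2 * a - 1) <= y i `^ (2 * a).
  have := y0 i; rewrite le_eqVlt => /predU1P[<-|yi0'].
    by rewrite mul0r powR_ge0.
  rewrite -[in leRHS](subrK 1 (2 * a)) powRS// ler_wpM2l// -subr_le0.
  have [E|E] := eqVneq (2 * a - 1) 0; first by rewrite E !powRr0 subrr.
  have := powR_monotone_sign (2 * a - 1) yi0' (ymax i isT).
  by rewrite nmulr_rge0// lt_neqAle E; lra.
rewrite (bigD1 i0)//=.
have S1 : y i0 `^ (2 * a) <= \sum_(i | i != i0) y i `^ (2 * a).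
  apply: le_trans (ler_sum _ (fun i _ => H i)).
  rewrite -mulr_suml -[in leLHS](subrK 1 (2 * a)) powRS//.
  by rewrite ler_wpM2r ?powR_ge0.
have S2 : 2 `^ (1 - a) <= 2 * y i0 `^ (2 * a).
  rewrite powRB ?pnatr_eq0 ?implybT// powRr1// ler_wpM2l// powRrM powR_mulrn//.
  rewrite -powRN -mulN1r powRrM powR_inv1//.
  by rewrite ge0_ler_powR ?nnegrE ?sqr_ge0 ?(ltW a0) ?(ltW M2).
lra.
Qed.

End power_sum_bound.

(** * Entropies *)

Section entropy.
Context {R : realType}.

Lemma ler_ln_sign (a S T : R) : a != 1 -> 0 < S -> 0 < T ->
  0 <= (a - 1) * (T - S) -> (1 - a)^-1 * ln T <= (1 - a)^-1 * ln S.
Proof.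
move=> a1 S0 T0; have [a_gt|a_lt|E] := ltrgtP a 1.
- by rewrite nmulr_rge0 ?subr_lt0// subr_le0 => TS;
    rewrite ler_wpM2l ?invr_ge0 ?subr_ge0 ?(ltW a_gt)// ler_ln ?posrE.
- rewrite pmulr_rge0 ?subr_gt0// subr_ge0 => ST.
  by rewrite ler_wnM2l ?invr_le0 ?subr_le0 ?(ltW a_lt)// ler_ln ?posrE.
- by rewrite E eqxx in a1.
Qed.

Lemma unit_sum0E d (x : 'rV[R]_d) : unit_sum0 x <->
  \sum_i x 0 i ^+ 2 = 1 /\ \sum_i x 0 i = 0.
Proof.
rewrite /unit_sum0 /norm2 /=; split=> -[x2 x1]; split => //; last
  by rewrite x2 sqrtr1.
rewrite -[LHS]sqr_sqrtr ?x2 ?expr1n//.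
by apply: sumr_ge0 => i _; exact: sqr_ge0.
Qed.

Lemma prob_ofE d (x : 'rV[R]_d) i : prob_of x 0 i = x 0 i ^+ 2.
Proof. by rewrite mxE real_normK ?num_real. Qed.

Lemma has_derivative_sum d (F : 'I_d -> R -> R) (x : R) (dF : 'I_d -> R) :
  (forall i, has_derivative (F i) x (dF i)) ->
  has_derivative (fun y => \sum_i F i y) x (\sum_i dF i).
Proof.
rewrite /has_derivative => H; have := is_derive_sum H.
by rewrite (_ : (\sum_i F i) = (fun y => \sum_i F i y))// funeqE => y;
  rewrite fct_sumE.
Qed.

(** Up to sign, the Renyi entropy of order [h + 1] is the difference quotient at
    1 of the logarithm of [a |-> \sum_i p_i ^ a]. *)
Lemma renyi_cvg_shannon d (p : 'rV[R]_d) :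
  (forall i, 0 <= p 0 i) -> \sum_i p 0 i = 1 ->
  renyi_entropy (h + 1) p @[h --> 0^'] --> shannon_entropy p.
Proof.
move=> p0 p1.
(* p 0 i `^ a for a != 0, as an exponential in a *)
pose F (i : 'I_d) (a : R) := if p 0 i == 0 then 0 else expR (a * ln (p 0 i)).
have F1 i : F i 1 = p 0 i.
  rewrite /F; case: eqVneq => [->//|pn0].
  by rewrite mul1r lnK// posrE lt_neqAle eq_sym pn0 p0.
have dF i : has_derivative (F i) 1 (p 0 i * ln (p 0 i)).
  rewrite /F -[X in _ (X * _)]F1 /F.
  case: eqVneq => [->|pn0]; first by rewrite mul0r; exact: has_derivative_cst.
  apply: has_derivative_expR; apply: has_derivative_eq; first by derivative.
  by rewrite mulr0 add0r mulr1.
have dS := has_derivative_sum dF.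
have S1 : \sum_i F i 1 = 1 by under eq_bigr do rewrite F1.
have : has_derivative (fun a => ln (\sum_i F i a)) 1
    (\sum_i p 0 i * ln (p 0 i)).
  rewrite -[X in has_derivative _ _ X]mul1r -[X in X * _]invr1.
  rewrite -[in X in X^-1]S1.
  by apply: has_derivative_ln => //; rewrite S1.
move=> [/= cv]; rewrite /derive /= => lE.
rewrite /shannon_entropy -lE.
apply: cvg_trans (cvgN cv); apply: near_eq_cvg; near=> h.
have h1 : h + 1 != 0.
  have : `|h| < 1 by near: h; exact: dnbhs0_lt.
  by rewrite ltr_norml => /andP[h1 _]; rewrite gt_eqF// -ltrBlDr sub0r.
change (- (h^-1 * (ln (\sum_i F i (h * 1 + 1)) - ln (\sum_i F i 1)))
  = renyi_entropy (h + 1) p).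
rewrite /renyi_entropy S1 ln1 subr0 mulr1.
have -> : 1 - (h + 1) = - h by rewrite opprD addrCA subrr addr0.
rewrite invrN mulNr; congr (- (_ * ln _)).
apply: eq_bigr => i _; rewrite /F /powR.
by case: eqVneq => // _; rewrite (negPf h1).
Unshelve. all: end_near. Qed.

End entropy.

(** * The two candidates for the minimum *)

Section witnesses.
Context {R : realType} (n : nat).
Implicit Types (a : R) (phi : R -> R).

Definition two_point : 'rV[R]_n.+2 := \row_i
  (if val i is 0 then Num.sqrt 2^-1
   else if val i is 1 then - Num.sqrt 2^-1 else 0).

Definition one_vs_rest : 'rV[R]_n.+2 := \row_i
  ((Num.sqrt ((n%:R + 1) * (n%:R + 2)))^-1
   * (if val i is 0 then n%:R + 1 else - 1)).

Lemma sum_two_point phi : \sum_i phi (two_point 0 i) =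
  phi (Num.sqrt 2^-1) + phi (- Num.sqrt 2^-1) + n%:R * phi 0.
Proof.
rewrite big_ord_recl big_ord_recl !mxE/= addrA; congr (_ + _).
under eq_bigr do rewrite mxE/=.
by rewrite sumr_const card_ord mulr_natl.
Qed.

Lemma sum_one_vs_rest phi (c := (Num.sqrt ((n%:R + 1) * (n%:R + 2)))^-1) :
  \sum_i phi (one_vs_rest 0 i) = phi (c * (n%:R + 1)) + (n%:R + 1) * phi (- c).
Proof.
rewrite big_ord_recl !mxE/=; congr (_ + _).
under eq_bigr do rewrite mxE/= mulrN1.
by rewrite sumr_const card_ord -(mulr_natl (phi _)) -natr1.
Qed.

Let n0 : 0 <= n%:R :> R. Proof. exact: ler0n. Qed.
Let k0 : 0 < n%:R + 1 :> R. Proof. by rewrite ltr_wpDl. Qed.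
Let d0 : 0 < n%:R + 2 :> R. Proof. by rewrite ltr_wpDl. Qed.

Lemma sum_two_point_sqr phi : phi 0 = 0 ->
  \sum_i phi (two_point 0 i ^+ 2) = 2 * phi 2^-1.
Proof.
move=> phi0; rewrite (sum_two_point (fun x => phi (x ^+ 2))) sqrrN.
by rewrite sqr_sqrtr ?invr_ge0// expr0n phi0 mulr0 addr0 -mulr2n mulr_natl.
Qed.

Lemma sum_one_vs_rest_sqr phi : \sum_i phi (one_vs_rest 0 i ^+ 2) =
  phi ((n%:R + 1) / (n%:R + 2))
  + (n%:R + 1) * phi (((n%:R + 1) * (n%:R + 2))^-1).
Proof.
rewrite (sum_one_vs_rest (fun x => phi (x ^+ 2))) sqrrN exprMn exprVn.
rewrite sqr_sqrtr ?mulr_ge0 ?(ltW k0) ?(ltW d0)//.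
by congr (phi _ + _); field; rewrite !gt_eqF.
Qed.

Lemma unit_sum0_two_point : unit_sum0 two_point.
Proof.
apply/unit_sum0E; split.
  by rewrite (sum_two_point_sqr (phi := id))// mulfV.
by rewrite (sum_two_point id) subrr mulr0 addr0.
Qed.

Lemma unit_sum0_one_vs_rest : unit_sum0 one_vs_rest.
Proof.
apply/unit_sum0E; split.
  by rewrite (sum_one_vs_rest_sqr id) /=; field; rewrite !gt_eqF.
by rewrite (sum_one_vs_rest id) mulrN mulrC subrr.
Qed.

Lemma renyi_two_point a : 0 < a -> a != 1 ->
  renyi_entropy a (prob_of two_point) = ln 2.
Proof.
move=> a0 a1; rewrite /renyi_entropy; under eq_bigr do rewrite prob_ofE.
rewrite (sum_two_point_sqr (phi := fun u => u `^ a)) ?powR0 ?gt_eqF//.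
have -> : 2 * 2^-1 `^ a = 2 `^ (1 - a) :> R.
  by rewrite powRB ?pnatr_eq0 ?implybT// powRr1// -powR_inv1// -powRrM mulN1r
    powRN.
by rewrite ln_powR mulKf// subr_eq0 eq_sym.
Qed.

Lemma sum_powR_one_vs_rest a : \sum_i (one_vs_rest 0 i ^+ 2) `^ a =
  ((n%:R + 1) `^ a + (n%:R + 1) `^ (1 - a)) / (n%:R + 2) `^ a.
Proof.
rewrite (sum_one_vs_rest_sqr (fun u => u `^ a)).
have V (x : R) : 0 < x -> x^-1 `^ a = (x `^ a)^-1.
  by move=> x0; rewrite -powR_inv1 ?(ltW x0)// -powRrM mulN1r powRN.
rewrite powRM ?invr_ge0 ?(ltW k0) ?(ltW d0)// !V ?mulr_gt0//.
rewrite powRM ?(ltW k0) ?(ltW d0)// powRB ?(gt_eqF k0) ?implybT//.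
rewrite powRr1 ?(ltW k0)//.
have : (n%:R + 1 : R) `^ a != 0 by rewrite gt_eqF ?powR_gt0.
have : (n%:R + 2 : R) `^ a != 0 by rewrite gt_eqF ?powR_gt0.
move: (_ `^ _) (_ `^ _) => b c b0 c0.
by field; rewrite b0 c0.
Qed.

Lemma renyi_one_vs_rest a : renyi_entropy a (prob_of one_vs_rest) =
  (1 - a)^-1 * ln (((n%:R + 1) `^ a + (n%:R + 1) `^ (1 - a)) / (n%:R + 2) `^ a).
Proof.
rewrite /renyi_entropy; under eq_bigr do rewrite prob_ofE.
by rewrite sum_powR_one_vs_rest.
Qed.

Lemma shannon_two_point : shannon_entropy (prob_of two_point) = ln 2.
Proof.
rewrite /shannon_entropy; under eq_bigr do rewrite prob_ofE.
rewrite (sum_two_point_sqr (phi := fun u => u * ln u)) ?mul0r//.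
by rewrite mulrA mulfV// mul1r lnV ?posrE// opprK.
Qed.

Lemma shannon_one_vs_rest : shannon_entropy (prob_of one_vs_rest) =
  ln (n%:R + 2) - n%:R / (n%:R + 2) * ln (n%:R + 1).
Proof.
rewrite /shannon_entropy; under eq_bigr do rewrite prob_ofE.
rewrite (sum_one_vs_rest_sqr (fun u => u * ln u)).
rewrite ln_div ?posrE// lnV ?posrE ?mulr_gt0// lnM ?posrE//.
by field; rewrite !gt_eqF.
Qed.

Lemma renyi_ge_witness a (x : 'rV[R]_n.+2) : (0 < n)%N -> 0 < a -> a != 1 ->
  unit_sum0 x ->
  renyi_entropy a (prob_of two_point) <= renyi_entropy a (prob_of x) \/
  renyi_entropy a (prob_of one_vs_rest) <= renyi_entropy a (prob_of x).
Proof.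
move=> npos a0 a1 /unit_sum0E[x2 x1].
have S0 : 0 < \sum_i (x 0 i ^+ 2) `^ a.
  rewrite lt_neqAle sumr_ge0 ?andbT; last by move=> i _; exact: powR_ge0.
  rewrite eq_sym; apply/eqP => /eqP; rewrite psumr_eq0; last first.
    by move=> i _; exact: powR_ge0.
  move=> /allP H; move/eqP: x2; rewrite big1 ?(eq_sym 0) ?oner_eq0// => i _.
  by have := H i (mem_index_enum i); rewrite powR_eq0 => /andP[/eqP].
rewrite renyi_two_point// renyi_one_vs_rest.
have -> : ln 2 = (1 - a)^-1 * ln (2 `^ (1 - a)) :> R.
  by rewrite ln_powR mulKf// subr_eq0 eq_sym.
rewrite /renyi_entropy; under eq_bigr do rewrite prob_ofE.
have := @power_sum_bound R 'I_n.+2 (x 0) n a (card_ord _) npos a0 x1 x2.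
by case=> H; [left|right]; apply: ler_ln_sign.
Qed.

Lemma shannon_ge_witness (x : 'rV[R]_n.+2) : (0 < n)%N -> unit_sum0 x ->
  shannon_entropy (prob_of two_point) <= shannon_entropy (prob_of x) \/
  shannon_entropy (prob_of one_vs_rest) <= shannon_entropy (prob_of x).
Proof.
move=> npos Dx.
have cv (y : 'rV[R]_n.+2) : unit_sum0 y ->
    renyi_entropy (h + 1) (prob_of y) @[h --> 0^']
      --> shannon_entropy (prob_of y).
  move=> /unit_sum0E[y2 _]; apply: renyi_cvg_shannon => [i|].
    by rewrite prob_ofE sqr_ge0.
  by rewrite -y2; apply: eq_bigr => i _; rewrite prob_ofE.
have lim_le (y : 'rV[R]_n.+2) : unit_sum0 y ->
    shannon_entropy (prob_of x) < shannon_entropy (prob_of y) ->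
    \forall h \near 0^',
      renyi_entropy (h + 1) (prob_of x) < renyi_entropy (h + 1) (prob_of y).
  move=> Dy xy.
  have H : renyi_entropy (h + 1) (prob_of y) - renyi_entropy (h + 1) (prob_of x)
      @[h --> 0^']
      --> shannon_entropy (prob_of y) - shannon_entropy (prob_of x).
    by apply: cvgB; exact: cv.
  move: xy; rewrite -subr_gt0 => /(cvgr_gt _ H).
  by apply: filterS => h /=; rewrite subr_gt0.
have [|ux] := leP (shannon_entropy (prob_of two_point))
  (shannon_entropy (prob_of x)).
  by left.
have [|vx] := leP (shannon_entropy (prob_of one_vs_rest))
  (shannon_entropy (prob_of x)).
  by right.
have U := lim_le _ unit_sum0_two_point ux.
have V := lim_le _ unit_sum0_one_vs_rest vx.
have small : \forall h \near (0 : R)^', `|h| < 1 by exact: dnbhs0_lt.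
have nz : \forall h \near (0 : R)^', h != 0 by exact: nbhs_dnbhs_neq.
have [h [[[Uh Vh] h1] hn0]] :=
  filter_ex (filterI (filterI (filterI U V) small) nz).
move: h1; rewrite ltr_norml => /andP[h1 _].
have [||/le_lt_trans/(_ Uh)|/le_lt_trans/(_ Vh)] :=
  @renyi_ge_witness (h + 1) x npos _ _ Dx.
- by rewrite -ltrBlDr sub0r.
- by rewrite -subr_eq0 addrK.
- by rewrite ltxx.
- by rewrite ltxx.
Qed.

End witnesses.

(** * Comparison of the two candidates for the Shannon entropy *)

Section comparison.
Context {R : realType}.

Lemma shannon_comparison_small (n : nat) : (0 < n <= 4)%N ->
  ln 2 <= ln (n%:R + 2) - n%:R / (n%:R + 2) * ln (n%:R + 1) :> R.
Proof.
move=> n04.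
have d0 : 0 < n%:R + 2 :> R by rewrite ltr_wpDl.
have k0 : 0 < n%:R + 1 :> R by rewrite ltr_wpDl.
suff H : ln (2 ^+ n.+2 * (n%:R + 1) ^+ n) <= ln ((n%:R + 2) ^+ n.+2) :> R.
  rewrite lnM ?posrE ?exprn_gt0// !lnXn// -!(mulr_natl (ln _)) in H.
  rewrite -subr_ge0 -(pmulr_rge0 _ d0); move: H; rewrite -subr_ge0.
  rewrite -(addn2 n) natrD.
  by congr (0 <= _); field; rewrite gt_eqF.
have P : 0 < 2 ^+ n.+2 * (n%:R + 1) ^+ n :> R.
  by apply: mulr_gt0; apply: exprn_gt0.
rewrite ler_ln; [|exact: P|exact: exprn_gt0].
rewrite natr1 -natrD addn2 -!natrX -natrM ler_nat.
by case: n n04 {d0 k0 P} => [|[|[|[|[|]]]]].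
Qed.

(** With [m = d - 1], the claim is [(1 + 1/m)^(m+1) m^2 <= 2^(m+1)], where the
    first factor is at most [expR ((m + 1) / m) <= expR (7 / 6) <= 32 / 9]. *)
Lemma shannon_comparison_large (n : nat) : (5 <= n)%N ->
  ln (n%:R + 2) - n%:R / (n%:R + 2) * ln (n%:R + 1) <= ln 2 :> R.
Proof.
move=> n5.
pose m : R := n%:R + 1.
have n5R : 5 <= n%:R :> R by rewrite ler_nat.
have m6 : 6 <= m by rewrite /m; lra.
have d0 : 0 < n%:R + 2 :> R by rewrite ltr_wpDl.
have m0 : 0 < m by lra.
have grow : 9 * 2 ^+ n.+2 >= 32 * m ^+ 2.
  rewrite /m -(subnKC n5); elim: (n - 5)%N => [|k IH].
    rewrite addn0 -!natrX; lra.
  rewrite addnS (exprS 2); move: IH; rewrite -[(5 + k).+1%:R]natr1.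
  have : 5 <= (5 + k)%:R :> R by rewrite ler_nat leq_addr.
  move: ((5 + k)%:R) (2 ^+ _) => u v u5 H.
  have : 0 <= u * (u - 5) by apply: mulr_ge0; lra.
  lra.
(* expR (7 / 72) <= (1 - 7 / 72)^-1 = 72 / 65, and (72 / 65) ^+ 12 <= 32 / 9;
   no larger bound would do, since 32 / 9 * 6 ^+ 2 = 2 ^+ 7 *)
have e : expR (7 / 6) <= 32 / 9 :> R.
  have e12 : expR (7 / 72) <= 72 / 65 :> R.
    rewrite -[X in expR X]opprK expRN -[72 / 65]invrK lef_pV2 ?posrE ?expR_gt0
      ?invr_gt0//.
    by apply: le_trans (expR_ge1Dx _); lra.
  rewrite (_ : 7 / 6 = 7 / 72 *+ 12); last by field.
  rewrite -(mulr_natl (7 / 72)) expRM_natl.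
  apply: (@le_trans _ _ ((72 / 65) ^+ 12)); last by lra.
  by rewrite lerXn2r ?nnegrE ?expR_ge0//; lra.
have b : ln (1 + m^-1) <= m^-1.
  by apply: le_ln1Dx; apply: lt_trans (_ : 0 < _); rewrite ?ltrN10 ?invr_gt0.
have lnd : ln (n%:R + 2) = ln m + ln (1 + m^-1).
  have m1 : 0 < 1 + m^-1 by rewrite ltr_wpDr ?invr_ge0 ?(ltW m0).
  rewrite -lnM //; congr (ln _).
  by rewrite mulrDr mulr1 mulfV ?gt_eqF// /m -addrA.
have bound : 2 * ln m + 7 / 6 <= (n%:R + 2) * ln 2.
  have -> : (n%:R + 2) * ln 2 = ln (2 ^+ n.+2) :> R.
    by rewrite lnXn// -(mulr_natl (ln _)) -(addn2 n) natrD.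
  have -> : 2 * ln m + 7 / 6 = ln (m ^+ 2 * expR (7 / 6)).
    by rewrite lnM ?posrE ?exprn_gt0 ?expR_gt0// lnXn// expRK mulr_natl.
  rewrite ler_ln; last exact: exprn_gt0; last first.
    by apply: mulr_gt0; [exact: exprn_gt0|exact: expR_gt0].
  have := ler_wpM2l (sqr_ge0 m) e; lra.
have md : (m + 1) / m <= 7 / 6.
  by rewrite ler_pdivrMr//; lra.
have H1 : 0 <= 7 / 6 - (m + 1) * ln (1 + m^-1).
  by rewrite subr_ge0; apply: le_trans md; apply: ler_wpM2l => //; lra.
have H2 : 0 <= (n%:R + 2) * ln 2 - (2 * ln m + 7 / 6).
  by rewrite subr_ge0.
rewrite -[_ <= _]subr_ge0 -(pmulr_rge0 _ d0).
have := addr_ge0 H1 H2; congr (0 <= _).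
rewrite lnd -/m; move: (ln (1 + _)) (ln m) => u v.
by rewrite /m; field; rewrite gt_eqF.
Qed.

End comparison.

Theorem corollary3 (R : realType) (d : nat) (hd : (3 <= d)%N) :
  (forall alpha : R, 0 < alpha < 1 \/ 1 < alpha ->
     is_min_on (@unit_sum0 R d) (fun x => renyi_entropy alpha (prob_of x))
       (Num.min (ln 2)
          ((1 - alpha)^-1 *
           ln (((d%:R - 1) `^ alpha + (d%:R - 1) `^ (1 - alpha))
               / d%:R `^ alpha))))
  /\
  is_min_on (@unit_sum0 R d) (fun x => shannon_entropy (prob_of x))
    (if (d <= 6)%N then ln 2
     else ln d%:R - (d%:R - 2) / d%:R * ln (d%:R - 1)).
Proof.
case: d hd => [|[|n]] // npos.
have dE : n.+2%:R = n%:R + 2 :> R by rewrite -(addn2 n) natrD.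
have kE : n.+2%:R - 1 = n%:R + 1 :> R by rewrite dE; ring.
have nE : n.+2%:R - 2 = n%:R :> R by rewrite dE; ring.
rewrite kE nE dE; split=> [a a01|].
  have [a0 a1] : 0 < a /\ a != 1.
    case: a01 => [/andP[a0 a1]|a1]; first by rewrite lt_eqF.
    by rewrite gt_eqF// (lt_trans ltr01).
  rewrite -(renyi_two_point n a0 a1) -renyi_one_vs_rest; split.
    rewrite minEle; case: ifP => _.
      by exists (two_point n) => //; exact: unit_sum0_two_point.
    by exists (one_vs_rest n) => //; exact: unit_sum0_one_vs_rest.
  move=> _ [x Dx <-]; rewrite ge_min.
  by case: (renyi_ge_witness npos a0 a1 Dx) => ->; rewrite ?orbT.
have -> : (if (n.+2 <= 6)%N then ln 2
    else ln (n%:R + 2) - n%:R / (n%:R + 2) * ln (n%:R + 1)) =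
  Num.min (shannon_entropy (prob_of (two_point n)))
    (shannon_entropy (prob_of (one_vs_rest n))) :> R.
  rewrite shannon_two_point shannon_one_vs_rest; case: ifPn => [n6|].
    rewrite min_l//.
    exact: shannon_comparison_small (introT andP (conj npos n6)).
  by rewrite -ltnNge => n6; rewrite min_r//; apply: shannon_comparison_large.
split.
  rewrite minEle; case: ifP => _.
    by exists (two_point n) => //; exact: unit_sum0_two_point.
  by exists (one_vs_rest n) => //; exact: unit_sum0_one_vs_rest.
move=> _ [x Dx <-]; rewrite ge_min.
by case: (shannon_ge_witness npos Dx) => ->; rewrite ?orbT.
Qed.
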